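(* Let $M\ge 1$ be an integer, $\eta\in(0,1]$, $\Psi>0$, $\lambda_{\rm SR}>0$, $\lambda_{\rm RD}>0$, $C_{th}>0$, and $\gamma_{th}=2^{2C_{th}}-1$. Let $\gamma_{\rm SR}$ be the maximum of $M$ independent exponential random variables of rate $\lambda_{\rm SR}$, and let $\gamma_{\rm RD}$ be an exponential random variable of rate $\lambda_{\rm RD}$ independent of $\gamma_{\rm SR}$. Let $$\rho^*=\frac{1}{1+\sqrt{\eta\gamma_{\rm RD}}},\qquad \gamma_{\rm D}=\frac{\eta\rho^*(1-\rho^* )\Psi\,\gamma_{\rm SR}\,\gamma_{\rm RD}}{\eta\rho^*\gamma_{\rm RD}+(1-\rho^* )},\qquad C_{\rm AF}=\tfrac12\log_2(1+\gamma_{\rm D}).$$ Then the outage probability ${\rm OP}_{\rm DPSR}=\Pr(C_{\rm AF}<C_{th})=\Pr(\gamma_{\rm D}<\gamma_{th})$ of the dynamic power splitting relaying scheme is $${\rm OP}_{\rm DPSR}=1+\sum_{t=0}^{\infty}\sum_{b=1}^{M}\frac{(-1)^{t+b}\binom{M}{b}2^{t+1}}{t!}\left(\frac{\lambda_{\rm RD}}{\eta}\right)^{\frac t4+\frac12}\left(\frac{b\lambda_{\rm SR}\gamma_{th}}{\Psi}\right)^{\frac{3t}4+\frac12}\exp\!\left(-\frac{b\lambda_{\rm SR}\gamma_{th}}{\Psi}\right)K_{1-\frac t2}\!\left(2\sqrt{\frac{b\lambda_{\rm SR}\lambda_{\rm RD}\gamma_{th}}{\eta\Psi}}\right).$$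
   Context: $K_v(\cdot)$ denotes the modified Bessel function of the second kind of order $v$. An exponential random variable of rate $\lambda>0$ has CDF $1-e^{-\lambda x}$ for $x\ge 0$. Interpretation: $\gamma_{\rm SR}$ is the channel gain from the best of $M$ sources to the relay, $\gamma_{\rm RD}=|h_{\rm RD}|^2$ the relay-to-destination channel gain, $\eta$ the energy conversion efficiency, $\rho^*$ the (random, channel-dependent) optimal power splitting ratio used in the dynamic scheme, $\Psi$ the source transmit-power-to-noise ratio, $\gamma_{\rm D}$ the SNR at the destination, and $C_{th}$ the target rate. *)

(* Defs.v *)
From HB Require Import structures.
From mathcomp Require Import all_boot all_order all_algebra.
From mathcomp Require Import all_classical all_reals all_analysis.

Set Implicit Arguments.
Unset Strict Implicit.
Unset Printing Implicit Defensive.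

Import Order.TTheory GRing.Theory Num.Theory.
Import numFieldNormedType.Exports.

Local Open Scope classical_set_scope.
Local Open Scope ring_scope.

Definition coshR (R : realType) (x : R) : R := (expR x + expR (- x)) / 2.

(* Modified Bessel function of the second kind of real order v:
   K_v(x) = int_0^oo exp(- x cosh t) cosh(v t) dt (DLMF 10.32.9), which
   converges and defines K_v for every real v, integral or not, as soon as
   x > 0; it is meaningful only for such x. *)
Definition besselK (R : realType) (v x : R) : R :=
  \int[@lebesgue_measure R]_(t in `[0, +oo[)
     (expR (- (x * coshR t)) * coshR (v * t)).

Definition log2 (R : realType) (x : R) : R := ln x / ln 2.

Definition exponential_RV d (T : measurableType d) (R : realType)
    (P : probability T R) (lambda : R) (X : {RV P >-> R}) : Prop :=
  forall x : R, 0 <= x -> cdf X x = (1 - expR (- (lambda * x)))%:E.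

Definition mutually_independent d (T : measurableType d) (R : realType)
    (P : probability T R) (I : finType) (X : I -> T -> R) : Prop :=
  forall (J : {set I}) (B : I -> set R),
    (forall i, i \in J -> measurable (B i)) ->
    P (\bigcap_(i in [set i | i \in J]) (X i @^-1` B i)) =
    (\prod_(i in J) P (X i @^-1` B i))%E.

Definition independent2 d (T : measurableType d) (R : realType)
    (P : probability T R) (X Y : T -> R) : Prop :=
  forall A B : set R, measurable A -> measurable B ->
    P ((X @^-1` A) `&` (Y @^-1` B)) = (P (X @^-1` A) * P (Y @^-1` B))%E.

(* Pointwise maximum of a nonempty finite family; the proof of 0 < M only
   provides the member of the family used as initial value. *)
Definition max_family (T : Type) (R : realType) (M : nat) (M_gt0 : (0 < M)%N)
    (X : 'I_M -> T -> R) (w : T) : R :=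
  \big[Num.max/X (Ordinal M_gt0) w]_(i < M) X i w.

Definition rho_star (R : realType) (eta gRD : R) : R :=
  1 / (1 + Num.sqrt (eta * gRD)).

(* End-to-end signal-to-noise ratio at the destination for a given power
   splitting ratio rho. *)
Definition snr_D (R : realType) (eta Psi rho gSR gRD : R) : R :=
  (eta * rho * (1 - rho) * Psi * gSR * gRD) / (eta * rho * gRD + (1 - rho)).

Definition snr_DPSR (R : realType) (eta Psi gSR gRD : R) : R :=
  snr_D eta Psi (rho_star eta gRD) gSR gRD.

Definition capacity_AF (R : realType) (snr : R) : R := 1 / 2 * log2 (1 + snr).

Definition gamma_threshold (R : realType) (Cth : R) : R := 2 `^ (2 * Cth) - 1.

Definition op_DPSR_term (R : realType) (M : nat)
    (eta Psi lambdaSR lambdaRD gth : R) (t b : nat) : R :=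
  (-1) ^+ (t + b) * 'C(M, b)%:R * 2 ^+ t.+1 / t`!%:R
  * (lambdaRD / eta) `^ (t%:R / 4 + 1 / 2)
  * (b%:R * lambdaSR * gth / Psi) `^ (3 * t%:R / 4 + 1 / 2)
  * expR (- (b%:R * lambdaSR * gth / Psi))
  * besselK (1 - t%:R / 2)
      (2 * Num.sqrt (b%:R * lambdaSR * lambdaRD * gth / (eta * Psi))).

(* Main.v *)
Require Import Defs.
From HB Require Import structures.
From mathcomp Require Import all_boot all_order all_algebra.
From mathcomp Require Import all_classical all_reals all_analysis.
From mathcomp Require Import measurable_realfun ring.

Import Order.TTheory GRing.Theory Num.Theory.
Import numFieldNormedType.Exports.

Local Open Scope classical_set_scope.
Local Open Scope ring_scope.

(* With s = sqrt (eta gRD) the SNR simplifies to Psi gSR s^2 / (1 + s)^2, so the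
   outage event is gSR < (gth / Psi) (1 + 1/s)^2. By independence its probability
   is the integral over gRD of the M-th power of an exponential cdf; expanding
   that power leaves the integrals of lambdaRD e^(- lambdaRD y - a (1 + 1/s)^2)
   with a = b lambdaSR gth / Psi. The cross term e^(- 2 a / s) is expanded as an
   exponential series. Its partial sums times e^(- a (1 + 1/s^2)) are bounded by
   e^(- a (1 - 1/s)^2) <= 1, so dominated convergence applies, and the
   substitution y = sqrt (q / p) e^x turns the integral of
   y^(v - 1) e^(- p y - q / y) into 2 (q / p)^(v / 2) K_v(2 sqrt (p q)). *)

(** * The Bessel integral through an exponential substitution *)

(** Substitution on [[-n, n]], whose images [[F (-n), F n]] exhaust []0, +oo[]; monotone convergence
    then passes to the limit on both sides. Nonnegativity dispenses with integrability: both sides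
    may be infinite. *)
Lemma ge0_integral_expR_substitution (R : realType) (c : R) (f : R -> R) :
  0 < c -> {in `]0, +oo[, continuous f} -> (forall x, 0 < x -> 0 <= f x) ->
  (\int[lebesgue_measure]_(x in `]0%R, +oo[) (f x)%:E =
   \int[lebesgue_measure]_x (f (c * expR x) * (c * expR x))%:E)%E.
Proof.
move=> c0 cf f0.
pose F (x : R) := c * expR x.
have F0 x : 0 < F x by rewrite mulr_gt0// expR_gt0.
have cF : continuous F.
  by move=> x; apply: cvgM; [exact: cvg_cst | exact: continuous_expR].
have dF : F^`()%classic = F.
  apply/funext => x; rewrite derive1E deriveZ; last exact: derivable_expR.
  by have /funeqP -> := @derive_expR R.
have ndF : {homo F : x y / x <= y} by move=> x y xy; rewrite ler_pM2l// ler_expR.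
have cfF : continuous (f \o F).
  move=> x; apply: continuous_comp; first exact: cF.
  by apply: cf; rewrite in_itv/= F0.
have nN (m n : nat) : (m <= n)%N -> - n%:R <= - m%:R :> R by rewrite lerN2 ler_nat.
have mono (n : nat) :
    (\int[lebesgue_measure]_(x in `[F (- n%:R)%R, F n%:R]) (f x)%:E =
    \int[lebesgue_measure]_(x in `[(- n%:R)%R, n%:R%R]) (f (F x) * F x)%:E)%E.
  rewrite (@integration_by_substitution_increasing _ F).
  - by apply: eq_integral => x _ /=; rewrite dF.
  - by rewrite (@le_trans _ _ 0)// oppr_le0.
  - by move=> x y _ _ xy; rewrite ltr_pM2l// ltr_expR.
  - by rewrite dF => x _; exact: cF.
  - by rewrite dF; apply/cvg_ex; exists (F (- n%:R)); apply/cvg_at_right_filter; exact: cF.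
  - by rewrite dF; apply/cvg_ex; exists (F (n%:R)); apply/cvg_at_left_filter; exact: cF.
  - split=> [x _||].
    + by apply: derivableZ; exact: derivable_expR.
    + by apply/cvg_at_right_filter; exact: cF.
    + by apply/cvg_at_left_filter; exact: cF.
  - apply: continuous_in_subspaceT => x; rewrite inE/= in_itv/= => /andP[Fx _].
    by apply: cf; rewrite in_itv/= andbT; exact: lt_le_trans Fx.
have posE : `]0, +oo[%classic = \bigcup_n `[F (- n%:R), F n%:R]%classic.
  apply/seteqP; split => [x/=|x [n _]/=]; rewrite !in_itv/= ?andbT; last first.
    by move=> /andP[Fx _]; exact: lt_le_trans Fx.
  move=> x0; have xc0 : 0 < x / c by rewrite divr_gt0.
  have [n] : exists n : nat, `|ln (x / c)| <= n%:R.
    by exists (Num.truncn `|ln (x / c)|).+1; rewrite ltW// truncnS_gt.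
  rewrite ler_norml => /andP[nl ln_le]; exists n => //=.
  have -> : x = c * expR (ln (x / c)) by rewrite lnK// mulrC divfK// gt_eqF.
  by rewrite in_itv/= !ler_pM2l// !ler_expR nl.
have TE : [set: R] = \bigcup_n `[- n%:R, n%:R]%classic.
  apply/seteqP; split => // x _.
  exists (Num.truncn `|x|).+1 => //=.
  by rewrite in_itv/= -ler_norml ltW// truncnS_gt.
rewrite posE [in RHS]TE.
apply: (@cvg_unique _ _
  (\int[lebesgue_measure]_(x in `[F (- n%:R)%R, F n%:R]) (f x)%:E @[n --> \oo])%E) => //.
  apply: ge0_nondecreasing_set_cvg_integral.
  - move=> m n mn; apply/subsetPset => x /=; rewrite !in_itv/= => /andP[mx xm].
    by rewrite (le_trans _ mx) ?ndF ?nN//= (le_trans xm) ?ndF ?ler_nat.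
  - by move=> i; exact: measurable_itv.
  - move=> i; apply/measurable_EFinP; apply: subspace_continuous_measurable_fun => //.
    apply: continuous_in_subspaceT => x; rewrite inE/= in_itv/= => /andP[Fx _].
    by apply: cf; rewrite in_itv/= andbT; exact: lt_le_trans Fx.
  - move=> i x /=; rewrite in_itv/= => /andP[Fx _]; rewrite lee_fin f0//.
    exact: lt_le_trans Fx.
rewrite (funext mono).
apply: ge0_nondecreasing_set_cvg_integral.
- move=> m n mn; apply/subsetPset => x /=; rewrite !in_itv/= => /andP[mx xm].
  by rewrite (le_trans _ mx) ?nN//= (le_trans xm) ?ler_nat.
- by move=> i; exact: measurable_itv.
- move=> i; apply/measurable_EFinP; apply: measurable_funTS.
  by apply: continuous_measurable_fun => x; apply: cvgM; [exact: cfF|exact: cF].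
- by move=> i x _; rewrite lee_fin mulr_ge0 ?f0// ltW.
Qed.

Lemma continuous_coshR (R : realType) : continuous (@coshR R).
Proof.
move=> x; apply: cvgM; last exact: cvg_cst.
apply: cvgD; first exact: continuous_expR.
by apply: continuous_comp; [exact: continuousN|exact: continuous_expR].
Qed.

Lemma continuous_powR_pos (R : realType) (v : R) :
  {in `]0, +oo[, continuous (fun x : R => x `^ v)}.
Proof.
move=> x x0; apply: differentiable_continuous; apply/derivable1_diffP.
exact: derivable_powR.
Qed.

(** A positive factor keeps an infinite [x] infinite, and [fine] sends both infinities to 0, so
    constants leave [fine] without a finiteness proof. *)
Lemma fine_EFin_mul (R : realType) (a : R) (x : \bar R) :
  0 < a -> fine (a%:E * x) = a * fine x.
Proof.
by move=> a0; case: x => [x| |]; rewrite //= ?gt0_muley ?gt0_muleNy ?lte_fin//= mulr0.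
Qed.

(** The scale [c = sqrt (q / p)] balances the two terms, [p c = q / c = r], so that
    [p y + q / y = 2 r cosh s] at [y = c e^s]. *)
Lemma Rintegral_powR_expR (R : realType) (v p q : R) : 0 < p -> 0 < q ->
  \int[lebesgue_measure]_(y in `]0, +oo[) (y `^ (v - 1) * expR (- (p * y) - q / y))
  = 2 * (q / p) `^ (v / 2) * besselK v (2 * Num.sqrt (p * q)).
Proof.
move=> p0 q0; set r := Num.sqrt (p * q).
pose c := Num.sqrt (q / p).
have qp0 : 0 < q / p by rewrite divr_gt0.
have c0 : 0 < c by rewrite sqrtr_gt0.
have r0 : 0 < r by rewrite sqrtr_gt0 mulr_gt0.
have pcr : p * c = r.
  apply/eqP; rewrite -(@eqrXn2 _ 2)// ?mulr_ge0 ?sqrtr_ge0 ?(ltW p0)//.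
  by rewrite exprMn !sqr_sqrtr ?(ltW qp0) ?mulr_ge0 ?(ltW p0) ?(ltW q0)//;
    apply/eqP; field; rewrite gt_eqF.
have qcr : q / c = r.
  rewrite -pcr; have -> : q = p * c ^+ 2.
    by rewrite sqr_sqrtr ?(ltW qp0)//; field; rewrite gt_eqF.
  by field; rewrite gt_eqF.
pose g s : R := expR (v * s) * expR (- (2 * r * coshR s)).
have cg : continuous g.
  move=> s; apply: cvgM; apply: continuous_comp; try exact: continuous_expR.
    by apply: cvgM; [exact: cvg_cst|exact: cvg_id].
  by apply: cvgN; apply: cvgM; [exact: cvg_cst|exact: continuous_coshR].
have g0 s : 0 <= g s by rewrite mulr_ge0 ?expR_ge0.
have mg D : measurable D -> measurable_fun D (EFin \o g).
  move=> mD; apply/measurable_EFinP; apply: measurable_funTS.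
  exact: continuous_measurable_fun.
(* Folding the line at 0 pairs [s] with [-s] and turns [e^(v s)] into [2 cosh (v s)], which leaves
   the integral defining [besselK]. *)
have gN s : g s + g (- s) = 2 * (expR (- (2 * r * coshR s)) * coshR (v * s)).
  rewrite /g [coshR (- s)]/coshR opprK [_ + expR s]addrC -/(coshR s) mulrN.
  by rewrite -mulrDl /coshR; field.
rewrite /Rintegral (@ge0_integral_expR_substitution _ c) //; last 2 first.
  move=> x x0; apply: cvgM; first exact: continuous_powR_pos.
  apply: continuous_comp; last exact: continuous_expR.
  apply: cvgB.
    by apply: cvgN; apply: cvgM; [exact: cvg_cst|exact: cvg_id].
  apply: cvgM; first exact: cvg_cst.
  by apply: cvgV => //; move: x0; rewrite in_itv/= andbT => /gt_eqF ->.
  by move=> x x0; rewrite mulr_ge0 ?powR_ge0 ?expR_ge0.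
(* The Jacobian [c e^s] raises the power from [v - 1] to [v]. *)
under eq_integral => s _.
  rewrite (_ : _ * _ = c `^ v * g s); last first.
    have ce0 : 0 < c * expR s by rewrite mulr_gt0// expR_gt0.
    rewrite mulrAC -[X in _ * X * _]powRr1 ?ltW// -powRD; last first.
      by apply/implyP => _; rewrite gt_eqF.
    rewrite subrK powRM ?(ltW c0) ?expR_ge0// -expRM (mulrC s) /g mulrA.
    rewrite mulrA; congr (_ * expR _).
    rewrite invfM -expRN mulrA pcr qcr /coshR.
    by field.
  rewrite EFinM; over.
rewrite ge0_integralZl//; last 3 first.
  exact: mg.
  by move=> x _; rewrite lee_fin.
  by rewrite lee_fin powR_ge0.
rewrite /= -(setUv `[0, +oo[%classic) ge0_integral_setU//=; last 4 first.
  exact: measurableC.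
  by rewrite setUv; exact: mg.
  by move=> x _; rewrite lee_fin.
  exact/disj_setPCl.
rewrite setCitvr integral_itv_bndo_bndc; last exact: mg.
rewrite -[X in `]-oo, X]]oppr0 ge0_integration_by_substitutionNy //; last first.
  exact: continuous_subspaceT.
rewrite -ge0_integralD//=; last 4 first.
  by move=> x _; rewrite lee_fin.
  exact: mg.
  by move=> x _; rewrite lee_fin.
  apply/measurable_EFinP; apply: measurableT_comp => //.
  exact: continuous_measurable_fun.
under eq_integral => s _.
  rewrite -EFinD gN EFinM; over.
rewrite ge0_integralZl//=; last 2 first.
  apply/measurable_EFinP; apply: measurable_funTS.
  apply: continuous_measurable_fun => s; apply: cvgM.
    apply: continuous_comp; last exact: continuous_expR.
    by apply: cvgN; apply: cvgM; [exact: cvg_cst|exact: continuous_coshR].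
  apply: continuous_comp; last exact: continuous_coshR.
  by apply: cvgM; [exact: cvg_cst|exact: cvg_id].
  by move=> s _; rewrite lee_fin mulr_ge0 ?divr_ge0 ?addr_ge0 ?expR_ge0.
have -> : (q / p) `^ (v / 2) = c `^ v.
  by rewrite /c -powR12_sqrt ?(ltW qp0)// -powRrM [v / 2]mulrC.
by rewrite !fine_EFin_mul ?powR_gt0// [LHS]mulrCA mulrA.
Qed.

(** * Termwise integration of the exponential series *)

Section exp_inverse_sqrt.
Context {R : realType} (lam eta a : R).
Hypotheses (lam0 : 0 < lam) (eta0 : 0 < eta) (a_ge0 : 0 <= a).

(** For [y <= 0] both the square root and its inverse default to 0, so the bounds on [phi] hold for
    every [y]; only continuity asks for [0 < y]. *)
Let u (y : R) : R := (Num.sqrt (eta * y))^-1.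

Let phi (t : nat) (y : R) : R :=
  lam * expR (- (lam * y)) * (expR (- (a * (1 + u y ^+ 2))) * exp_coeff (- (2 * a * u y)) t).

Let f (y : R) : R := lam * expR (- (lam * y)) * expR (- (a * (1 + u y) ^+ 2)).

Let D : set R := `]0%R, +oo[%classic.

Let mD : measurable D. Proof. exact: measurable_itv. Qed.

Let u_ge0 y : 0 <= u y. Proof. by rewrite invr_ge0 sqrtr_ge0. Qed.

Let series_exp_coeff_le_expR (x : R) n : 0 <= x -> series (exp_coeff x) n <= expR x.
Proof.
move=> x0; apply: nondecreasing_cvgn_le; last exact: is_cvg_series_exp_coeff.
by apply: nondecreasing_series => k _ _; exact: exp_coeff_ge0.
Qed.

(** Completing the square: [a (1 + u^2) - 2 a u = a (1 - u)^2 >= 0]. As [s] is arbitrary, one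
    estimate serves single terms and partial sums alike. *)
Let phi_sum_le (s : R) y : `|s| <= expR (2 * a * u y) ->
  `|lam * expR (- (lam * y)) * (expR (- (a * (1 + u y ^+ 2))) * s)|
     <= lam * expR (- (lam * y)).
Proof.
move=> hs; rewrite normrM ger0_norm ?mulr_ge0 ?expR_ge0 ?(ltW lam0)//.
rewrite -[leRHS]mulr1 ler_wpM2l ?mulr_ge0 ?expR_ge0 ?(ltW lam0)//.
rewrite normrM ger0_norm ?expR_ge0// (le_trans (ler_wpM2l (expR_ge0 _) hs))//.
rewrite -expRD -[leRHS]expR0 ler_expR.
rewrite (_ : _ + _ = - (a * (1 - u y) ^+ 2)); last by ring.
by rewrite oppr_le0 mulr_ge0 ?a_ge0 ?sqr_ge0.
Qed.

Let phi_le t y : `|phi t y| <= lam * expR (- (lam * y)).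
Proof.
apply: phi_sum_le; have au : 0 <= 2 * a * u y by rewrite !mulr_ge0 ?a_ge0.
apply: le_trans _ (series_exp_coeff_le_expR _ t.+1 au).
(* The absolute value of term [t] is the last summand of the partial sum of length [t.+1] at
   [2 a u], whose other summands are nonnegative. *)
rewrite /series /= big_nat_recr//= /exp_coeff/= normrM normrX normrN (ger0_norm au).
rewrite [`|_^-1|]ger0_norm ?invr_ge0// lerDr.
by apply: sumr_ge0 => i _; rewrite mulr_ge0 ?exprn_ge0 ?invr_ge0.
Qed.

Let phi_series_le n y : `|\sum_(0 <= t < n) phi t y| <= lam * expR (- (lam * y)).
Proof.
rewrite -!mulr_sumr; apply: phi_sum_le.
have au : 0 <= 2 * a * u y by rewrite !mulr_ge0 ?a_ge0.
apply: le_trans _ (series_exp_coeff_le_expR _ n au).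
apply: le_trans (ler_norm_sum _ _ _) _; apply: ler_sum => i _.
rewrite /exp_coeff/= normrM normrX normrN (ger0_norm au).
by rewrite [`|_^-1|]ger0_norm ?invr_ge0.
Qed.

Let continuous_u : {in `]0, +oo[, continuous u}.
Proof.
move=> y; rewrite in_itv/= andbT => y0; apply: cvgV.
  by rewrite gt_eqF// sqrtr_gt0 mulr_gt0.
apply: continuous_comp; last exact: sqrt_continuous.
by apply: cvgM; [exact: cvg_cst|exact: cvg_id].
Qed.

Let cont_exp : continuous (fun y : R => lam * expR (- (lam * y))).
Proof.
move=> y; apply: cvgM; first exact: cvg_cst.
apply: continuous_comp; last exact: continuous_expR.
by apply: cvgN; apply: cvgM; [exact: cvg_cst|exact: cvg_id].
Qed.

Let mphi t : measurable_fun D (EFin \o phi t).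
Proof.
apply/measurable_EFinP; apply: open_continuous_measurable_fun.
  exact: interval_open.
move=> y; rewrite inE/= => yD.
apply: cvgM; first exact: cont_exp.
apply: cvgM.
  apply: continuous_comp; last exact: continuous_expR.
  apply: cvgN; apply: cvgM; first exact: cvg_cst.
  apply: cvgD; first exact: cvg_cst.
  apply: (@continuous_comp _ _ _ u (fun x => x ^+ 2)).
    exact: continuous_u.
  exact: exprn_continuous.
apply: cvgM; last exact: cvg_cst.
apply: (@continuous_comp _ _ _ (fun y => - (2 * a * u y)) (fun x => x ^+ t)); last first.
  exact: exprn_continuous.
by apply: cvgN; apply: cvgM; [exact: cvg_cst|exact: continuous_u].
Qed.

Let mf : measurable_fun D (EFin \o f).
Proof.
apply/measurable_EFinP; apply: open_continuous_measurable_fun.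
  exact: interval_open.
move=> y; rewrite inE/= => yD.
apply: cvgM; first exact: cont_exp.
apply: continuous_comp; last exact: continuous_expR.
apply: cvgN; apply: cvgM; first exact: cvg_cst.
apply: (@continuous_comp _ _ _ (fun y => 1 + u y) (fun x => x ^+ 2)); last first.
  exact: exprn_continuous.
by apply: cvgD; [exact: cvg_cst|exact: continuous_u].
Qed.

Let int_exp : lebesgue_measure.-integrable D (EFin \o (fun y => lam * expR (- (lam * y)))).
Proof.
have iD : lebesgue_measure.-integrable D (EFin \o exponential_pdf lam).
  by apply: (integrableS measurableT) => //; exact: integrable_exponential_pdf.
apply: eq_integrable iD => //.
move=> y; rewrite /D inE/= in_itv/= andbT => y0.
by rewrite /= exponential_pdfE ?ltW// mulNr.
Qed.

Let int_phi t : lebesgue_measure.-integrable D (EFin \o phi t).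
Proof.
have := @le_integrable _ _ _ lebesgue_measure D mD _ _ (mphi t) _ int_exp.
apply => y _.
by rewrite /= lee_fin (le_trans (phi_le t y))// ler_norm.
Qed.

(** The second exponential is at most 1, so the exponential density dominates. The case [a = 0] is
    included for the sake of the [b = 0] term of the binomial expansion. *)
Lemma integrable_expR_inv_sqrt : lebesgue_measure.-integrable D (EFin \o f).
Proof.
have := @le_integrable _ _ _ lebesgue_measure D mD _ _ mf _ int_exp.
apply => y _.
rewrite /= lee_fin normrM ler_piMr// ger0_norm ?expR_ge0// -expR0 ler_expR.
by rewrite oppr_le0 mulr_ge0 ?a_ge0 ?sqr_ge0.
Qed.

Let phi_cvg y : (fun n => \sum_(0 <= t < n) phi t y) @ \oo --> f y.
Proof.
rewrite (_ : f y = lam * expR (- (lam * y)) *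
   (expR (- (a * (1 + u y ^+ 2))) * expR (- (2 * a * u y)))); last first.
  by rewrite /f -[in RHS]expRD; congr (_ * expR _); ring.
under eq_fun do rewrite -!mulr_sumr.
apply: cvgM; first exact: cvg_cst.
by apply: cvgM; [exact: cvg_cst|exact: is_cvg_series_exp_coeff].
Qed.

Let powE (x r : R) : 0 < x -> x `^ r = expR (r * ln x).
Proof. by move=> x0; rewrite /powR gt_eqF. Qed.

(** Both sides are exponentials of linear forms in [ln lam], [ln eta] and [ln a], whose coefficients
    agree. *)
Let constE (t : nat) : 0 < a -> lam * a ^+ t * eta `^ (- (t%:R / 2)) *
    (a / eta / lam) `^ ((1 - t%:R / 2) / 2) =
  (lam / eta) `^ (t%:R / 4 + 1 / 2) * a `^ (3 * t%:R / 4 + 1 / 2).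
Proof.
move=> a0; rewrite -powR_mulrn// -[X in X * _ * _ * _](@lnK _ lam)//.
rewrite !powE ?divr_gt0// !ln_div ?posrE ?divr_gt0// -!expRD; congr expR.
by field.
Qed.

(** The factor [u^t] contributes [y^(- t / 2)], so [phi t] is a constant times the Bessel integrand
    with [v = 1 - t / 2], [p = lam] and [q = a / eta]. *)
Let phi_integral t : 0 < a -> \int[lebesgue_measure]_(y in D) phi t y =
  (-1) ^+ t * 2 ^+ t.+1 / t`!%:R * (lam / eta) `^ (t%:R / 4 + 1 / 2)
  * a `^ (3 * t%:R / 4 + 1 / 2) * expR (- a)
  * besselK (1 - t%:R / 2) (2 * Num.sqrt (a * lam / eta)).
Proof.
move=> a0; pose C := lam * a ^+ t * eta `^ (- (t%:R / 2)) *
  ((-1) ^+ t * 2 ^+ t / t`!%:R * expR (- a)).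
pose h y := y `^ (1 - t%:R / 2 - 1) * expR (- (lam * y) - a / eta / y).
(* Dividing by [C] carries integrability from [phi t] over to [h]. *)
have C0 : C != 0.
  have e_neq0 : eta `^ (- (t%:R / 2)) != 0 by rewrite lt0r_neq0// powR_gt0.
  have x_neq0 : expR (- a) != 0 by rewrite lt0r_neq0// expR_gt0.
  have f_neq0 : t`!%:R != 0 :> R by rewrite pnatr_eq0 -lt0n fact_gt0.
  by rewrite !mulf_neq0 ?expf_neq0 ?invr_neq0 ?oppr_eq0 ?oner_eq0 ?f_neq0
    ?pnatr_eq0 ?(lt0r_neq0 lam0) ?(lt0r_neq0 a0).
have phiE : {in D, phi t =1 (fun y => C * h y)}.
  move=> y; rewrite /D inE/= in_itv/= andbT => y0.
  have ey0 : 0 < eta * y by rewrite mulr_gt0.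
  have uE : u y ^+ t = eta `^ (- (t%:R / 2)) * y `^ (1 - t%:R / 2 - 1).
    rewrite -powR_mulrn// /u -powR12_sqrt ?(ltW ey0)// -powRN -powRrM.
    rewrite powRM ?(ltW eta0) ?(ltW y0)//.
    by congr (_ `^ _ * _ `^ _); field.
  have u2E : u y ^+ 2 = (eta * y)^-1 by rewrite exprVn sqr_sqrtr ?(ltW ey0).
  rewrite /phi /exp_coeff/= exprNn exprMn uE exprMn u2E /C /h.
  rewrite (_ : - (a * _) = - a - a / eta / y); last first.
    by field; rewrite !gt_eqF.
  rewrite !expRD; ring.
transitivity (\int[lebesgue_measure]_(y in D) (C * h y)).
  exact: eq_Rintegral.
have int_h : lebesgue_measure.-integrable D (EFin \o h).
  have := @integrableZl _ _ _ lebesgue_measure D mD C^-1 _ (int_phi t).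
  apply: eq_integrable => // y yD /=.
  by rewrite phiE//= -EFinM mulrA mulVf// mul1r.
rewrite RintegralZl// Rintegral_powR_expR// ?divr_gt0//.
rewrite [Num.sqrt (lam * _)](_ : _ = Num.sqrt (a * lam / eta)); last first.
  by congr Num.sqrt; ring.
move: (constE t a0); rewrite /C exprS.
set P1 := (lam / eta) `^ _; set P2 := a `^ _; set K := besselK _ _ => cE.
transitivity (P1 * P2 * ((-1) ^+ t * (2 * 2 ^+ t) / t`!%:R * expR (- a) * K));
  last by ring.
by rewrite -cE; ring.
Qed.


Lemma cvg_series_besselK : 0 < a ->
  series (fun t => (-1) ^+ t * 2 ^+ t.+1 / t`!%:R
    * (lam / eta) `^ (t%:R / 4 + 1 / 2)
    * a `^ (3 * t%:R / 4 + 1 / 2) * expR (- a)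
    * besselK (1 - t%:R / 2) (2 * Num.sqrt (a * lam / eta))) @ \oo -->
  \int[lebesgue_measure]_(y in D) f y.
Proof.
move=> a0; rewrite [X in series X](funext (fun t => esym (phi_integral t a0))).
have [] := @dominated_convergence _ _ _ lebesgue_measure D mD
  (fun n y => (\sum_(0 <= t < n) phi t y)%:E) (EFin \o f)
  (EFin \o (fun y => lam * expR (- (lam * y)))).
- move=> n; apply/measurable_EFinP; apply: measurable_sum => t.
  by have /measurable_EFinP := mphi t.
- exact: mf.
- by apply: nearW => y _; apply: cvg_EFin; [exact: nearW|exact: phi_cvg].
- exact: int_exp.
- by apply: nearW => y n _; rewrite /= lee_fin phi_series_le.
move=> int_f _ cvg_int.
(* The limit integral is finite, so convergence in the extended reals descends to the reals. *)
rewrite -[X in _ --> X]fineK in cvg_int; last exact: integrable_fin_num.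
move/fine_cvg : cvg_int; apply: cvg_trans; apply: near_eq_cvg; apply: nearW => n /=.
rewrite /series/= sum_fine; last first.
  by move=> t _; apply: integrable_fin_num => //; exact: int_phi.
congr fine; rewrite -integral_sum//; apply: eq_integral => y _.
by rewrite sumEFin.
Qed.

End exp_inverse_sqrt.

(** * Exponential laws: distribution function and density *)

(** The intervals []a, b]] are stable under intersection and generate the Borel sets, their masses
    are differences of distribution functions, and the []-n, n]] cover the line. *)
Lemma probability_eq_itvNyc (R : realType) (m1 m2 : probability (measurableTypeR R) R) :
  (forall x : R, m1 `]-oo, x]%classic = m2 `]-oo, x]%classic) ->
  forall A, measurable A -> m1 A = m2 A.
Proof.
move=> m12 A mA.
have itvE (m : probability (measurableTypeR R) R) (a b : R) : a <= b ->
    m `]a, b]%classic = (m `]-oo, b]%classic - m `]-oo, a]%classic)%E.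
  move=> ab; have -> : `]a, b]%classic = `]-oo, b] `\` `]-oo, a].
    by rewrite -[RHS]setCK setCD setCitvl setUC -[LHS]setCK setCitv.
  rewrite measureD ?setIidr//; first exact: subset_itvl.
  by rewrite -ge0_fin_numE// fin_num_measure.
refine (@measure_unique _ R (measurableTypeR R) (@ocitv R)
  (fun n => `](- n%:R), n%:R]%classic) _ _ _ _ m1 m2 _ _ _ mA) => //.
- by move=> B C; exact: ocitvI.
- by move=> n; exact: is_ocitv.
- apply/seteqP; split => // x _; exists (Num.truncn `|x|).+1 => //=.
  by have := truncnS_gt `|x|; rewrite ltr_norml in_itv/= => /andP[-> /ltW ->].
- move=> _ [[a b] _ <-] /=; have [ab|ba] := leP a b; first by rewrite !itvE// !m12.
  by rewrite set_itv_ge ?measure0// bnd_simp -leNgt ltW.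
- by move=> n; rewrite -ge0_fin_numE// fin_num_measure.
Qed.

(* The canonical measurable structure of R and measurableTypeR R, which carries
   lebesgue_measure, have the same measurable sets but different displays, so
   that measures on one are not measures on the other. *)
Definition to_measurableTypeR {d} {T : measurableType d} {R : realType}
    {X : T -> R} (mX : measurable_fun setT X) : {mfun T >-> measurableTypeR R} :=
  MeasurableFun.Pack (MeasurableFun.Class
    (isMeasurableFun.Build _ _ T (measurableTypeR R) X mX)).

Section exponential_distribution.
Context {R : realType} (lam : R).
Hypothesis lam0 : 0 < lam.

Lemma exponential_prob_itvNyc (x : R) : 0 <= x ->
  exponential_prob lam `]-oo, x]%classic = (1 - expR (- (lam * x)))%:E.
Proof.
move=> x0.
have -> : exponential_prob lam `]-oo, x]%classic = exponential_prob lam `[0, x]%classic.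
  rewrite /exponential_prob [LHS]integral_mkcond [RHS]integral_mkcond.
  apply: eq_integral => y _; rewrite /= !patchE.
  rewrite !mem_setE !in_itv/=; have [y0|y0]/= := leP 0 y; first by [].
  by rewrite lt0_exponential_pdf// if_same.
move: x0; rewrite le_eqVlt => /predU1P[<-|x0].
  by rewrite /exponential_prob set_itv1 integral_set1 mulr0 oppr0 expR0 subrr.
by rewrite exponential_prob_itv0c// EFinB mulNr.
Qed.

(** A law with a density has no atoms. This reconciles the strict inequality of the outage event
    with the closed half-lines of [cdf]. *)
Lemma exponential_prob_itvNyo (x : R) :
  exponential_prob lam `]-oo, x[%classic = exponential_prob lam `]-oo, x]%classic.
Proof.
rewrite /exponential_prob integral_itv_bndo_bndc//.
by apply/measurable_EFinP/measurable_funTS; exact: measurable_exponential_pdf.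
Qed.

(** [exponential_RV] prescribes the distribution function only for [0 <= x]; its value 0 at 0 forces
    it to vanish at negative [x] by monotonicity. *)
Lemma exponential_RV_distribution d (T : measurableType d) (P : probability T R)
    (X : {RV P >-> R}) (mX : measurable_fun setT (X : T -> R)) :
  exponential_RV lam X -> forall A, measurable A ->
  distribution P (to_measurableTypeR mX) A = exponential_prob lam A.
Proof.
move=> hX.
have neg0 (m : probability (measurableTypeR R) R) (x : R) :
    m `]-oo, 0]%classic = 0%E -> x < 0 -> m `]-oo, x]%classic = 0%E.
  move=> m0 x0; apply/eqP; rewrite eq_le measure_ge0 andbT -m0.
  by rewrite le_measure ?inE//; apply: subset_itvl; rewrite bnd_simp ltW.
have H := @probability_eq_itvNyc R (distribution P (to_measurableTypeR mX))
  (exponential_prob lam).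
apply: H => x.
have [x0|x0] := leP 0 x; first by rewrite /= exponential_prob_itvNyc// -hX.
rewrite [LHS]neg0// ?[RHS]neg0//=.
  by rewrite exponential_prob_itvNyc// mulr0 oppr0 expR0 subrr.
by have := hX 0 (lexx _); rewrite mulr0 oppr0 expR0 subrr.
Qed.

Lemma dominates_exponential_prob : exponential_prob lam `<< (@lebesgue_measure R).
Proof.
apply/null_content_dominatesP => A mA A0; apply: null_set_integral => //.
by apply/measurable_EFinP/measurable_funTS; exact: measurable_exponential_pdf.
Qed.

Lemma integral_exponential_prob (f : R -> \bar R) :
  (exponential_prob lam).-integrable setT f ->
  (\int[exponential_prob lam]_x f x =
   \int[lebesgue_measure]_x (f x * (exponential_pdf lam x)%:E))%E.
Proof.
move=> intf; have mf := measurable_int _ intf.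
rewrite -(Radon_Nikodym_change_of_variables dominates_exponential_prob)//=.
apply: ae_eq_integral => //.
- apply: emeasurable_funM => //; apply: (measurable_int lebesgue_measure).
  by apply: Radon_Nikodym_integrable; exact: dominates_exponential_prob.
- apply: emeasurable_funM => //=; apply/measurableT_comp => //=.
  exact: measurable_exponential_pdf.
- apply: ae_eqe_mul2l => /=.
  rewrite Radon_NikodymE//=; first exact: dominates_exponential_prob.
  move=> abmu.
  case: cid => /= h [h1 h2 h3].
  apply: integral_ae_eq => //=.
  (* The Radon-Nikodym derivative and the density have the same integral over each measurable set,
     hence agree almost everywhere. *)
  + by apply/measurableT_comp =>//; exact: measurable_exponential_pdf.
  + by move=> E E01 mE; rewrite -h3.
Qed.

End exponential_distribution.

(** The density vanishes on the negatives and the point 0 is null; discarding it leaves the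
    half-line where [sqrt (eta y)] is invertible. *)
Lemma integral_mul_exponential_pdf (R : realType) (lam : R) (f : R -> \bar R) :
  measurable_fun [set: measurableTypeR R] f ->
  (\int[lebesgue_measure]_x (f x * (exponential_pdf lam x)%:E) =
   \int[lebesgue_measure]_(x in `]0%R, +oo[) (f x * (lam * expR (- (lam * x)))%:E))%E.
Proof.
move=> mf; rewrite [RHS]integral_itv_obnd_cbnd; last first.
  apply: emeasurable_funM; first exact: measurable_funTS.
  apply/measurable_EFinP; apply: measurable_funTS.
  apply: continuous_measurable_fun => x; apply: cvgM; first exact: cvg_cst.
  apply: continuous_comp; last exact: continuous_expR.
  by apply: cvgN; apply: cvgM; [exact: cvg_cst|exact: cvg_id].
rewrite [RHS]integral_mkcond; apply: eq_integral => x _ /=; rewrite patchE.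
rewrite mem_setE in_itv/= andbT; have [x0|x0] := leP 0 x.
  by rewrite exponential_pdfE// mulNr.
by rewrite lt0_exponential_pdf// mule0.
Qed.

(** * Independence and the maximum over the sources *)

Section independence.
Context d (T : measurableType d) (R : realType) (P : probability T R).

(** Independence makes the joint law agree with the product measure on rectangles, hence everywhere;
    the product measure is by construction the integral of the masses of sections. *)
Lemma independent2_probability_xsection (X Y : {mfun T >-> measurableTypeR R}) :
  independent2 P Y X ->
  forall A : set (measurableTypeR R * measurableTypeR R), measurable A ->
  P [set w | A (X w, Y w)] =
  (\int[distribution P X]_x distribution P Y (xsection A x))%E.
Proof.
move=> indep A mA.
have mXY : measurable_fun setT (fun w => (X w, Y w)).
  by apply: measurable_fun_pair; exact: measurable_funPT.
pose XY : {mfun T >-> (measurableTypeR R * measurableTypeR R)%type} :=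
  MeasurableFun.Pack (MeasurableFun.Class (isMeasurableFun.Build _ _ _ _ _ mXY)).
rewrite -[RHS]/((distribution P X \x distribution P Y)%E A).
rewrite (@product_measure_unique _ _ _ _ _ (distribution P X) (distribution P Y)
  (distribution P XY))//.
move=> B C mB mC; rewrite /= muleC -indep//; congr (P _).
by apply/seteqP; split => w /= [].
Qed.

Lemma measurable_max_family (M : nat) (M_gt0 : (0 < M)%N) (X : 'I_M -> T -> R) :
  (forall i, measurable_fun setT (X i)) -> measurable_fun setT (max_family M_gt0 X).
Proof.
move=> mX; rewrite /max_family; elim: (index_enum _) => [|i r IH].
  by under eq_fun do rewrite big_nil; exact: mX.
by under eq_fun do rewrite big_cons; exact: measurable_maxr.
Qed.

Lemma max_family_lt (M : nat) (M_gt0 : (0 < M)%N) (X : 'I_M -> T -> R) (x : R) (w : T) :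
  max_family M_gt0 X w < x <-> forall i, X i w < x.
Proof.
split=> [h i|h]; last by apply: bigmax_lt.
by apply: le_lt_trans h; exact: le_bigmax.
Qed.

(** The maximum lies below [x] exactly when every variable does, so independence over the full index
    set yields [M] equal factors. *)
Lemma probability_max_exponential_lt (M : nat) (M_gt0 : (0 < M)%N) (lam x : R)
    (X : 'I_M -> {RV P >-> R}) :
  0 < lam -> 0 <= x ->
  (forall i, exponential_RV lam (X i)) ->
  mutually_independent P (fun i => (X i : T -> R)) ->
  P (max_family M_gt0 (fun i => (X i : T -> R)) @^-1` `]-oo, x[) =
  ((1 - expR (- (lam * x))) ^+ M)%:E.
Proof.
move=> lam0 x0 Xexp Xind.
have := Xind [set: 'I_M]%SET (fun=> `]-oo, x[%classic) (fun _ _ => measurable_itv _).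
rewrite (_ : \bigcap_(i in _) _ =
    max_family M_gt0 (fun i => (X i : T -> R)) @^-1` `]-oo, x[); last first.
  apply/seteqP; split => w /=.
    move=> h; rewrite in_itv/=; apply/max_family_lt => i.
    by have := h i; rewrite /= inE in_itv/=; apply.
  by rewrite in_itv/= => /max_family_lt h i _; rewrite /= in_itv/=.
move=> ->.
under eq_bigr => i _.
  have -> : P (X i @^-1` `]-oo, x[) = (1 - expR (- (lam * x)))%:E.
    rewrite -exponential_prob_itvNyc// -exponential_prob_itvNyo.
    by rewrite -(exponential_RV_distribution _ lam0 _ _ _ _ (measurable_funPT (X i)) (Xexp i)).
  over.
by rewrite prodEFin/= prodr_const cardsT card_ord.
Qed.

End independence.

(** * The outage event and its probability as an integral *)

Section outage_event.
Context {R : realType}.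
Implicit Types eta Psi x y : R.

(** With [s = sqrt (eta y)] and [rho = 1 / (1 + s)], the denominator [eta rho y + 1 - rho] collapses
    to [s], which cancels one factor of the numerator. *)
Lemma snr_DPSRE eta Psi x y : 0 < eta ->
  snr_DPSR eta Psi x y =
  Psi * Num.sqrt (eta * y) ^+ 2 * x / (1 + Num.sqrt (eta * y)) ^+ 2.
Proof.
move=> eta0; rewrite /snr_DPSR /snr_D /rho_star.
(* When the root is 0, in particular for negative [y], [rho_star] is 1 and both sides vanish. *)
have := sqrtr_ge0 (eta * y); rewrite le_eqVlt => /predU1P[<-|s0].
  by rewrite addr0 divr1 subrr expr0n/= !(mulr0, mul0r).
have ey : eta * y = Num.sqrt (eta * y) ^+ 2 by rewrite sqr_sqrtr// ltW// -sqrtr_gt0.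
set s := Num.sqrt _ in s0 ey *.
have -> : y = s ^+ 2 / eta by rewrite -ey mulrC mulKf// gt_eqF.
have s1 : 0 < 1 + s by rewrite addr_gt0.
have s2 : 0 < s ^+ 2 + (1 + s - 1) by rewrite addrAC subrr add0r addr_gt0 ?exprn_gt0.
by field; rewrite !lt0r_neq0.
Qed.

Lemma capacity_AF_lt (Cth snr : R) : 0 < Cth ->
  (capacity_AF snr < Cth) = (snr < gamma_threshold Cth).
Proof.
move=> C0; have ln2 : 0 < ln 2 :> R by rewrite ln_gt0// ltr1n.
rewrite /capacity_AF /log2 /gamma_threshold ltrBrDl /powR gt_eqF//.
have -> : (1 / 2 * (ln (1 + snr) / ln 2) < Cth) = (ln (1 + snr) < 2 * Cth * ln 2).
  rewrite mulrA ltr_pdivrMr// div1r ltr_pdivrMl//; congr (_ < _); ring.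
(* For [1 + snr <= 0] the logarithm defaults to 0 and both inequalities hold, since [0 < Cth]. *)
have [s0|s0] := leP (1 + snr) 0.
  rewrite ln0// (le_lt_trans s0) ?expR_gt0//.
  by rewrite !mulr_gt0.
by rewrite -{2}(@lnK _ (1 + snr))// ltr_expR.
Qed.

End outage_event.

Lemma outage_probabilityE (d : measure_display) (T : measurableType d) (R : realType)
    (P : probability T R) (M : nat) (M_gt0 : (0 < M)%N)
    (eta Psi lambdaSR lambdaRD gth : R)
    (X : 'I_M -> {RV P >-> R}) (gRD : {RV P >-> R}) :
  0 < eta -> 0 < Psi -> 0 < lambdaSR -> 0 < lambdaRD -> 0 < gth ->
  (forall i, exponential_RV lambdaSR (X i)) ->
  mutually_independent P (fun i => (X i : T -> R)) ->
  exponential_RV lambdaRD gRD ->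
  let gSR := max_family M_gt0 (fun i => (X i : T -> R)) in
  independent2 P gSR gRD ->
  (P [set w | (snr_DPSR eta Psi (gSR w) (gRD w) < gth)%R] =
   \int[lebesgue_measure]_(y in `]0%R, +oo[)
     ((1 - expR (- (lambdaSR * (gth / Psi * (1 + (Num.sqrt (eta * y))^-1) ^+ 2)))) ^+ M
      * (lambdaRD * expR (- (lambdaRD * y))))%:E)%E.
Proof.
move=> eta0 Psi0 lSR0 lRD0 gth0 Xexp Xind gRDexp gSR indep.
(* The outage event with denominators cleared, the first coordinate standing for [gRD] and the
   second for [gSR]. It is the preimage of a half-line under a measurable function. *)
pose A : set (measurableTypeR R * measurableTypeR R) :=
  [set p | Psi * Num.sqrt (eta * p.1) ^+ 2 * p.2 - gth * (1 + Num.sqrt (eta * p.1)) ^+ 2 < 0].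
have mA : measurable A.
  have msqrt : measurable_fun [set: measurableTypeR R * measurableTypeR R]
      (fun p => Num.sqrt (eta * p.1)).
    apply: (@measurableT_comp _ _ _ _ _ _
      (fun y : measurableTypeR R => Num.sqrt (eta * y))) => //.
    apply: continuous_measurable_fun => y.
    apply: continuous_comp; last exact: sqrt_continuous.
    by apply: cvgM; [exact: cvg_cst|exact: cvg_id].
  have mdiff : measurable_fun [set: measurableTypeR R * measurableTypeR R]
      (fun p => Psi * Num.sqrt (eta * p.1) ^+ 2 * p.2
                - gth * (1 + Num.sqrt (eta * p.1)) ^+ 2).
    apply: measurable_funB; apply: measurable_funM => //.
    - by apply: measurable_funM => //; exact: measurable_funX.
    - by apply: measurable_funX; exact: measurable_funD.
  rewrite -[A]setTI.
  have := mdiff measurableT `]-oo, 0[%classic (measurable_itv _).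
  by congr measurable; congr (_ `&` _); apply/seteqP; split => p /=; rewrite in_itv.
have mgSR : measurable_fun setT gSR.
  by apply: measurable_max_family => i; exact: measurable_funPT.
pose X' := to_measurableTypeR (measurable_funPT gRD).
pose Y' := to_measurableTypeR mgSR.
have -> : [set w | snr_DPSR eta Psi (gSR w) (gRD w) < gth] = [set w | A (X' w, Y' w)].
  apply/seteqP; split => w; rewrite /A /= snr_DPSRE// subr_lt0 ltr_pdivrMr//;
    by rewrite exprn_gt0// ltr_pwDl// sqrtr_ge0.
rewrite (independent2_probability_xsection _ _ _ P X' Y')//.
have mG : measurable_fun setT (fun y => distribution P Y' (xsection A y)).
  exact: measurable_fun_xsection.
transitivity (\int[exponential_prob lambdaRD]_y distribution P Y' (xsection A y))%E.
  apply: eq_measure_integral => B mB _.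
  exact: exponential_RV_distribution.
rewrite integral_exponential_prob//; last first.
  (* Masses of sections are at most 1, hence integrable against a probability. *)
  have ic := finite_measure_integrable_cst (exponential_prob lambdaRD) 1 measurableT.
  have := @le_integrable _ _ _ (exponential_prob lambdaRD) setT measurableT
    _ (EFin \o cst 1) mG _ (ic lRD0).
  move=> /(_ lRD0); apply => y _; rewrite /= gee0_abs// normr1.
  by apply: probability_le1; exact: measurable_xsection.
rewrite integral_mul_exponential_pdf//.
apply: eq_integral => y; rewrite inE/= in_itv/= andbT => y0.
rewrite [RHS]EFinM; congr (_ * _)%E.
have s0 : 0 < Num.sqrt (eta * y) by rewrite sqrtr_gt0 mulr_gt0.
rewrite -(probability_max_exponential_lt _ _ _ P M M_gt0 lambdaSR _ X)//; last first.
  by rewrite !mulr_ge0 ?sqr_ge0// ?invr_ge0 ltW.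
rewrite /distribution /pushforward /=; congr (P _).
(* For [0 < y] the section of [A] at [y] is the open half-line below this threshold. *)
have -> : gth / Psi * (1 + (Num.sqrt (eta * y))^-1) ^+ 2 =
    gth * (1 + Num.sqrt (eta * y)) ^+ 2 / (Psi * Num.sqrt (eta * y) ^+ 2).
  by field; rewrite !lt0r_neq0.
apply/seteqP; split => w /=; rewrite /xsection/= inE /A/= in_itv/= subr_lt0;
  by rewrite ltr_pdivlMr ?mulr_gt0 ?exprn_gt0// mulrC.
Qed.

(** * Binomial expansion and assembly of the double series *)

Lemma integral_binomial_expR (R : realType) (M : nat) (eta lam k : R) :
  0 < eta -> 0 < lam -> 0 <= k ->
  (\int[lebesgue_measure]_(y in `]0%R, +oo[)
     ((1 - expR (- (k * (1 + (Num.sqrt (eta * y))^-1) ^+ 2))) ^+ M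
      * (lam * expR (- (lam * y))))%:E)%E =
  (1 + \sum_(1 <= b < M.+1) (-1) ^+ b * 'C(M, b)%:R *
    \int[lebesgue_measure]_(y in `]0%R, +oo[)
      (lam * expR (- (lam * y))
       * expR (- (b%:R * k * (1 + (Num.sqrt (eta * y))^-1) ^+ 2))))%:E.
Proof.
move=> eta0 lam0 k0.
pose f (b : nat) (y : R) := lam * expR (- (lam * y))
  * expR (- (b%:R * k * (1 + (Num.sqrt (eta * y))^-1) ^+ 2)).
have int_f b : lebesgue_measure.-integrable `]0, +oo[%classic (EFin \o f b).
  by apply: integrable_expR_inv_sqrt; rewrite // mulr_ge0.
pose c (b : nat) : R := (-1) ^+ b * 'C(M, b)%:R.
transitivity (\sum_(0 <= b < M.+1)
    \int[lebesgue_measure]_(y in `]0%R, +oo[) ((c b)%:E * (f b y)%:E))%E.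
  rewrite -integral_sum//; last by move=> b; apply: integrableZl => //; exact: int_f.
  apply: eq_integral => y _; under [RHS]eq_bigr do rewrite -EFinM.
  rewrite sumEFin; congr EFin.
  rewrite exprBn mulr_suml big_mkord; apply: eq_bigr => b _.
  rewrite expr1n mulr1 -expRM_natl /c /f !mulrN !mulrA -mulr_natr; ring.
transitivity ((\sum_(0 <= b < M.+1)
    c b * \int[lebesgue_measure]_(y in `]0%R, +oo[) f b y)%:E).
  rewrite -sumEFin; apply: eq_bigr => b _.
  rewrite integralZl//; last exact: int_f.
  by rewrite [RHS]EFinM /Rintegral fineK//; apply: integrable_fin_num => //; exact: int_f.
(* The [b = 0] summand is the total mass of the exponential density and supplies the leading 1. *)
congr EFin; rewrite big_ltn//; congr (_ + _).
rewrite /c bin0 expr0 !mul1r /Rintegral.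
rewrite -[RHS]/(fine 1%E) -(integral_exponential_pdf lam0); congr fine.
transitivity (\int[lebesgue_measure]_x (cst 1%E x * (exponential_pdf lam x)%:E))%E.
  rewrite integral_mul_exponential_pdf//; apply: eq_integral => y _.
  by rewrite /= mul1e /f !mul0r oppr0 expR0 mulr1.
by apply: eq_integral => y _; rewrite /= mul1e.
Qed.

(** Separates the binomial weight from the [t]-th term of [cvg_series_besselK] taken at
    [a = b lambdaSR gth / Psi]. *)
Lemma op_DPSR_termE (R : realType) (M : nat) (eta Psi lambdaSR lambdaRD gth : R)
    (t b : nat) :
  op_DPSR_term M eta Psi lambdaSR lambdaRD gth t b =
  (-1) ^+ b * 'C(M, b)%:R * ((-1) ^+ t * 2 ^+ t.+1 / t`!%:R
    * (lambdaRD / eta) `^ (t%:R / 4 + 1 / 2)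
    * (b%:R * (lambdaSR * (gth / Psi))) `^ (3 * t%:R / 4 + 1 / 2)
    * expR (- (b%:R * (lambdaSR * (gth / Psi))))
    * besselK (1 - t%:R / 2)
        (2 * Num.sqrt (b%:R * (lambdaSR * (gth / Psi)) * lambdaRD / eta))).
Proof.
rewrite /op_DPSR_term exprD !(mulrA _ lambdaSR) !(mulrA _ gth).
rewrite [Num.sqrt (b%:R * lambdaSR * lambdaRD * gth / _)](_ : _ =
  Num.sqrt (b%:R * lambdaSR * gth / Psi * lambdaRD / eta)).
  by ring.
by congr Num.sqrt; rewrite invfM; ring.
Qed.

Theorem theorem3 (d : measure_display) (T : measurableType d) (R : realType)
    (P : probability T R)
    (M : nat) (M_gt0 : (0 < M)%N)
    (eta Psi lambdaSR lambdaRD Cth : R)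
    (eta_gt0 : 0 < eta) (eta_le1 : eta <= 1) (Psi_gt0 : 0 < Psi)
    (lambdaSR_gt0 : 0 < lambdaSR) (lambdaRD_gt0 : 0 < lambdaRD)
    (Cth_gt0 : 0 < Cth)
    (X : 'I_M -> {RV P >-> R}) (gRD : {RV P >-> R})
    (X_exp : forall i : 'I_M, exponential_RV lambdaSR (X i))
    (X_indep : mutually_independent P (fun i : 'I_M => (X i : T -> R)))
    (gRD_exp : exponential_RV lambdaRD gRD) :
  let gSR : T -> R := max_family M_gt0 (fun i : 'I_M => (X i : T -> R)) in
  forall (gSR_gRD_indep : independent2 P gSR gRD),
  let gth : R := gamma_threshold Cth in
  let gD : T -> R := fun w => snr_DPSR eta Psi (gSR w) (gRD w) in
  let C_AF : T -> R := fun w => capacity_AF (gD w) in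
  let outage_series : R^nat := series (fun t : nat =>
    \sum_(1 <= b < M.+1) op_DPSR_term M eta Psi lambdaSR lambdaRD gth t b) in
  [/\ P [set w | C_AF w < Cth] = P [set w | gD w < gth],
      cvgn outage_series
    & P [set w | C_AF w < Cth] = (1 + limn outage_series)%:E].
Proof.
move=> gSR indep gth gD C_AF outage_series.
have gth0 : 0 < gth.
  by rewrite subr_gt0 /gth /powR gt_eqF// expR_gt1 !mulr_gt0// ln_gt0// ltr1n.
have k0 : 0 < lambdaSR * (gth / Psi) by rewrite mulr_gt0// divr_gt0.
have CE : P [set w | C_AF w < Cth] = P [set w | gD w < gth].
  by congr (P _); apply/funext => w; rewrite /= capacity_AF_lt.
have cvg_series : outage_series @ \oo -->
    \sum_(1 <= b < M.+1) (-1) ^+ b * 'C(M, b)%:R *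
    \int[lebesgue_measure]_(y in `]0%R, +oo[)
      (lambdaRD * expR (- (lambdaRD * y)) * expR (- (b%:R * (lambdaSR * (gth / Psi))
        * (1 + (Num.sqrt (eta * y))^-1) ^+ 2))).
  (* Partial sums in [t] commute with the finite sum over [b], so convergence reduces to a single
     [b]. *)
  rewrite (_ : outage_series = (fun n => \sum_(1 <= b < M.+1) (-1) ^+ b * 'C(M, b)%:R *
    series (fun t => (-1) ^+ t * 2 ^+ t.+1 / t`!%:R
      * (lambdaRD / eta) `^ (t%:R / 4 + 1 / 2)
      * (b%:R * (lambdaSR * (gth / Psi))) `^ (3 * t%:R / 4 + 1 / 2)
      * expR (- (b%:R * (lambdaSR * (gth / Psi))))
      * besselK (1 - t%:R / 2)
          (2 * Num.sqrt (b%:R * (lambdaSR * (gth / Psi)) * lambdaRD / eta))) n)).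
    (* Keeping the membership of [b] in the range retains [1 <= b], which makes the parameter [a] of
       the Bessel series positive. *)
    rewrite big_seq; under eq_fun do rewrite big_seq.
    apply: cvg_big => [|b]; first exact: add_continuous.
    rewrite mem_index_iota => /andP[b1 _].
    apply: cvgM; first exact: cvg_cst.
    have bk0 : 0 < b%:R * (lambdaSR * (gth / Psi)) by rewrite mulr_gt0 ?ltr0n.
    by apply: cvg_series_besselK => //; exact: ltW.
  apply/funext => n; rewrite /outage_series /series/= exchange_big/=.
  apply: eq_bigr => b _; rewrite mulr_sumr; apply: eq_bigr => t _.
  exact: op_DPSR_termE.
split=> //; first by apply/cvg_ex; eexists; exact: cvg_series.
rewrite CE (outage_probabilityE _ _ _ _ _ M_gt0 _ _ lambdaSR lambdaRD)//.
under eq_integral do rewrite mulrA.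
rewrite (@integral_binomial_expR _ M) ?(ltW k0)//.
by rewrite (cvg_lim _ cvg_series).
Qed.
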